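(* Let $L\in\mathbb{R}^{n\times n}$ be a graph Laplacian, let $\{1,\ldots,n\}=C_1\cup C_2\cup\cdots\cup C_k$ be a partition into nonempty pairwise disjoint blocks, let $U=[u_1,\ldots,u_k]\in\mathbb{R}^{n\times k}$ be the matrix whose columns are the indicator vectors $u_j$ of the blocks $C_j$, and let $\varepsilon>0$. Then the optimization problem $$ \begin{aligned} \min_{M\in\mathbb{R}^{n\times n}}\quad &\|M-L\|_F^2\\ \text{subject to}\quad & MU=0,\quad M=M^T,\quad M_{ij}\le 0\ \ (i\neq j),\\ & M_j\succeq \varepsilon P_j,\qquad j=1,\ldots,k \end{aligned} $$ admits a unique global minimizer.
   Context: A (weighted) graph Laplacian on $\{1,\ldots,n\}$ is a matrix of the form $D-W$, where $W=[w_{ij}]\in\mathbb{R}^{n\times n}$ is symmetric with $w_{ij}\ge 0$ for $i\ne j$ and $w_{ii}=0$, and $D=\operatorname{diag}(d_1,\ldots,d_n)$ with $d_i=\sum_j w_{ij}$. The indicator vector $u_j\in\mathbb{R}^n$ of $C_j$ has entries $(u_j)_i=1$ if $i\in C_j$ and $0$ otherwise. Put $n_j=|C_j|$; $M_j=M[C_j,C_j]\in\mathbb{R}^{n_j\times n_j}$ is the principal submatrix of $M$ indexed by $C_j$; $P_j=I_{n_j}-\frac{1}{n_j}\mathbf{1}_{n_j}\mathbf{1}_{n_j}^T$, where $\mathbf{1}_m$ is the all-ones vector in $\mathbb{R}^m$. $A\succeq B$ means that $A-B$ is positive semidefinite (for symmetric $A,B$). $\|\cdot\|_F$ is the Frobenius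 norm. *)

(* Defs.v *)
From HB Require Import structures.
From mathcomp Require Import all_boot all_order all_algebra reals.

Set Implicit Arguments.
Unset Strict Implicit.
Unset Printing Implicit Defensive.

Import Order.TTheory GRing.Theory Num.Theory.
Local Open Scope ring_scope.

Definition graph_laplacian (R : realType) (n : nat) (L : 'M[R]_n) : Prop :=
  exists W : 'M[R]_n,
    [/\ W^T = W,
        forall i j, i != j -> 0 <= W i j,
        forall i, W i i = 0
      & L = diag_mx (\row_i \sum_j W i j) - W].

Definition block_partition (n k : nat) (C : 'I_k -> {set 'I_n}) : Prop :=
  [/\ forall j, C j != set0,
      forall i j, i != j -> [disjoint C i & C j]
    & \bigcup_j C j = [set: 'I_n]].

Definition indicator_vec (R : realType) (n : nat) (A : {set 'I_n}) : 'cV[R]_n :=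
  \col_i (i \in A)%:R.

Definition indicator_mx (R : realType) (n k : nat) (C : 'I_k -> {set 'I_n}) :
    'M[R]_(n, k) :=
  \matrix_(i, j) indicator_vec R (C j) i 0.

(* [enum_val] lists the elements of [A] in increasing order. *)
Definition principal_submx (R : realType) (n : nat) (M : 'M[R]_n)
    (A : {set 'I_n}) : 'M[R]_#|A| :=
  mxsub enum_val enum_val M.

Definition ones (R : realType) (m : nat) : 'cV[R]_m := const_mx 1.

Definition centering_mx (R : realType) (m : nat) : 'M[R]_m :=
  1%:M - m%:R^-1 *: (ones R m *m (ones R m)^T).

Definition psd (R : realType) (m : nat) (A : 'M[R]_m) : Prop :=
  A^T = A /\ forall x : 'cV[R]_m, 0 <= (x^T *m A *m x) 0 0.

Definition loewner_ge (R : realType) (m : nat) (A B : 'M[R]_m) : Prop :=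
  psd (A - B).

Definition frobenius_norm (R : realType) (m n : nat) (A : 'M[R]_(m, n)) : R :=
  Num.sqrt (\sum_i \sum_j `|A i j| ^+ 2).

Definition feasible (R : realType) (n k : nat) (C : 'I_k -> {set 'I_n})
    (eps : R) (M : 'M[R]_n) : Prop :=
  [/\ M *m indicator_mx R C = 0,
      M = M^T,
      forall i j, i != j -> M i j <= 0
    & forall j, loewner_ge (principal_submx M (C j))
                           (eps *: centering_mx R #|C j|)].

Definition global_minimizer (R : realType) (T : Type) (S : T -> Prop)
    (f : T -> R) (x : T) : Prop :=
  S x /\ forall y, S y -> f x <= f y.

(* Main.v *)
(** The feasible set is convex, closed under entrywise limits, and nonempty: it
    contains the matrix with diagonal blocks [eps P_j] and zeros elsewhere. The
    minimizer is therefore the Frobenius projection of [L] onto this set. The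
    parallelogram identity, applied at midpoints (which are feasible), makes
    every minimizing sequence Cauchy and forces two minimizers to coincide. *)

Require Import Defs.
From mathcomp Require Import all_boot all_order all_algebra reals.
From mathcomp Require Import boolp classical_sets interval_inference topology normedtype sequences.
From mathcomp Require Import ring lra.

Set Implicit Arguments.
Unset Strict Implicit.
Unset Printing Implicit Defensive.

Import Order.TTheory GRing.Theory Num.Theory.
Import numFieldNormedType.Exports.
Local Open Scope ring_scope.

(** * Frobenius norm and entrywise limits *)

(** In finite dimension this is the usual convergence; the entrywise form reduces every limit to one
    of real sequences. *)
Definition entrywise_cvg (R : realType) (m n : nat) (u : nat -> 'M[R]_(m, n))
    (A : 'M[R]_(m, n)) : Prop :=
  forall i j, ((fun p => u p i j) @ \oo --> A i j)%classic.

Lemma sqr_frobenius (R : realType) (m n : nat) (A : 'M[R]_(m, n)) :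
  frobenius_norm A ^+ 2 = \sum_i \sum_j A i j ^+ 2.
Proof.
rewrite /frobenius_norm sqr_sqrtr; last first.
  by apply: sumr_ge0 => i _; apply: sumr_ge0 => j _; rewrite exprn_ge0.
by apply: eq_bigr => i _; apply: eq_bigr => j _; rewrite real_normK ?num_real.
Qed.

(** The parallelogram law for [A - L] and [B - L], whose sum is twice the midpoint minus [L]. Solved
    for the distance, it turns a lower bound at the midpoint into an upper bound on that
    distance. *)
Lemma frobenius_parallelogram (R : realType) (m n : nat)
    (A B L : 'M[R]_(m, n)) :
  frobenius_norm (A - B) ^+ 2 =
    2 * frobenius_norm (A - L) ^+ 2 + 2 * frobenius_norm (B - L) ^+ 2
    - 4 * frobenius_norm (2^-1 *: (A + B) - L) ^+ 2.
Proof.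
rewrite !sqr_frobenius !mulr_sumr -sumrN -!big_split /=.
apply: eq_bigr => i _; rewrite !mulr_sumr -sumrN -!big_split /=.
by apply: eq_bigr => j _; rewrite !mxE; field.
Qed.

Lemma sqr_entry_le_frobenius (R : realType) (m n : nat) (A : 'M[R]_(m, n)) i j :
  A i j ^+ 2 <= frobenius_norm A ^+ 2.
Proof.
rewrite sqr_frobenius (bigD1 i) //= (bigD1 j) //= -addrA lerDl.
by rewrite addr_ge0 ?sumr_ge0 // => *; rewrite ?sumr_ge0 // => *; rewrite sqr_ge0.
Qed.

Lemma cvg_sum_pointwise (R : realType) (I : Type) (r : seq I)
    (f : I -> nat -> R) (l : I -> R) :
  (forall i, (f i @ \oo --> l i)%classic) ->
  ((fun p => \sum_(i <- r) f i p) @ \oo --> \sum_(i <- r) l i)%classic.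
Proof.
by move=> fl; apply: cvg_big => // x; exact: add_continuous.
Qed.

Lemma entrywise_cvg_frobenius (R : realType) (m n : nat)
    (u : nat -> 'M[R]_(m, n)) (A L : 'M[R]_(m, n)) :
  entrywise_cvg u A ->
  ((fun p => frobenius_norm (u p - L) ^+ 2) @ \oo
     --> frobenius_norm (A - L) ^+ 2)%classic.
Proof.
move=> uA; rewrite sqr_frobenius; under eq_fun do rewrite sqr_frobenius.
apply: cvg_sum_pointwise => i; apply: cvg_sum_pointwise => j.
rewrite !mxE expr2; under eq_fun do rewrite !mxE expr2.
by apply: cvgM; apply: cvgB (uA i j) (cvg_cst _).
Qed.

(** The assumed rate is the one a minimizing sequence with errors [1/(p+1)] satisfies. It makes each
    entry a real Cauchy sequence. *)
Lemma entrywise_cauchy_cvg (R : realType) (m n : nat)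
    (u : nat -> 'M[R]_(m, n)) :
  (forall p q, frobenius_norm (u p - u q) ^+ 2
     <= 2 * (p.+1%:R^-1 + q.+1%:R^-1)) ->
  exists A, entrywise_cvg u A.
Proof.
move=> cau.
have small (e : R) : 0 < e ->
    exists N, forall p, (N <= p)%N -> 2 * (N.+1%:R^-1 + p.+1%:R^-1) < e ^+ 2.
  (* Two reciprocals below [e^2/4] give twice their sum below [e^2]. *)
  move=> e0; have e40 : 0 < e ^+ 2 / 4 by rewrite divr_gt0 ?exprn_gt0.
  have [N _ hN] := near_infty_natSinv_lt (PosNum e40).
  have invS_lt p : (N <= p)%N -> p.+1%:R^-1 < e ^+ 2 / 4 by exact: hN.
  exists N => p Np; move: (invS_lt N (leqnn N)) (invS_lt p Np).
  move: N.+1%:R^-1 p.+1%:R^-1 (e ^+ 2) => x y z; lra.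
have cvu i j : cvg ((fun p => u p i j) @ \oo)%classic.
  (* It suffices that a tail lies in one ball of radius [e]; its center is the [N]-th term. *)
  apply: cauchy_cvg; apply: cauchy_exP => e e0; have [N hN] := small e e0.
  exists (u N i j); exists N => // p /= Np.
  rewrite /ball /= -(ltr_pXn2r (n := 2)) ?nnegrE ?normr_ge0 ?(ltW e0) //.
  rewrite real_normK ?num_real //; apply: le_lt_trans (hN p Np).
  have := le_trans (sqr_entry_le_frobenius (u N - u p) i j) (cau N p).
  by rewrite !mxE.
exists (\matrix_(i, j) lim ((fun p => u p i j) @ \oo)%classic) => i j.
by rewrite mxE; exact: cvu.
Qed.

(** * Projection onto a closed convex set *)

Lemma frobenius_projection (R : realType) (m n : nat)
    (S : 'M[R]_(m, n) -> Prop) (L : 'M[R]_(m, n)) :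
  (exists A, S A) ->
  (forall A B, S A -> S B -> S (2^-1 *: (A + B))) ->
  (forall u A, (forall p, S (u p)) -> entrywise_cvg u A -> S A) ->
  exists! A, global_minimizer S (fun B => frobenius_norm (B - L) ^+ 2) A.
Proof.
move=> [A0 SA0] midS closedS.
pose f (B : 'M[R]_(m, n)) := frobenius_norm (B - L) ^+ 2.
pose E : set R := [set f B | B in S]%classic.
have lbE : has_lbound E by exists 0 => _ [B _ <-]; exact: sqr_ge0.
have infE : has_inf E by split=> //; exists (f A0), A0.
have inf_le B : S B -> inf E <= f B by move=> SB; apply: ge_inf => //; exists B.
have [u hu] : {u : nat -> 'M[R]_(m, n) &
    forall p, S (u p) /\ f (u p) < inf E + p.+1%:R^-1}.
  apply: (@choice _ _ (fun p B => S B /\ f B < inf E + p.+1%:R^-1)) => p.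
  have p0 : 0 < p.+1%:R^-1 :> R by rewrite invr_gt0.
  by have [_ [B SB <-] fB] := inf_adherent p0 infE; exists B.
have [A uA] : exists A, entrywise_cvg u A.
  apply: entrywise_cauchy_cvg => p q.
  rewrite (frobenius_parallelogram _ _ L).
  have [[Sp fp] [Sq fq]] := (hu p, hu q).
  (* The midpoint has value at least [inf E], so the squared distance is at most [2(inf E + x) +
     2(inf E + y) - 4 inf E = 2(x + y)]. *)
  have := inf_le _ (midS _ _ Sp Sq).
  move: fp fq; rewrite /f; move: p.+1%:R^-1 q.+1%:R^-1 => x y; lra.
have SA : S A by apply: closedS uA => p; exact: (hu p).1.
(* Pass to the limit in [f (u p) <= inf E + 1/(p+1)]. *)
have fA : f A <= inf E.
  have cvg_bound : ((fun p => inf E + harmonic p) @ \oo --> inf E)%classic.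
    by rewrite -[X in (_ --> X)%classic]addr0; apply: cvgD (cvg_cst _) cvg_harmonic.
  apply: (ler_cvg_to (entrywise_cvg_frobenius (L := L) uA) cvg_bound).
  by apply: nearW => p; exact: ltW (hu p).2.
exists A; split; first by split=> // B /inf_le; exact: le_trans.
move=> B [SB minB]; apply/matrixP => i j.
have fB : f B <= f A := minB _ SA.
have := sqr_entry_le_frobenius (A - B) i j.
rewrite (frobenius_parallelogram _ _ L) => le_AB.
(* Neither [f A] nor [f B] exceeds [inf E], while the midpoint value is at least [inf E]; the
   parallelogram bound is then at most 0. *)
have : (A - B) i j ^+ 2 <= 0.
  have := inf_le _ (midS _ _ SA SB); move: fA fB le_AB; rewrite /f; lra.
by rewrite exprn_even_le0 //= !mxE subr_eq0 => /eqP.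
Qed.

(** * The positive semidefinite cone *)

Lemma quadratic_formE (R : realType) (m : nat) (A : 'M[R]_m) (x : 'cV[R]_m) :
  (x^T *m A *m x) 0 0 = \sum_j \sum_i x i 0 * A i j * x j 0.
Proof.
by rewrite mxE; apply: eq_bigr => j _; rewrite mxE mulr_suml;
   apply: eq_bigr => i _; rewrite mxE.
Qed.

(** For fixed [x] the quadratic form is a finite linear combination of the entries, so its sign
    passes to the limit, as does symmetry. *)
Lemma psd_entrywise_closed (R : realType) (m : nat) (u : nat -> 'M[R]_m)
    (A : 'M[R]_m) :
  (forall p, psd (u p)) -> entrywise_cvg u A -> psd A.
Proof.
move=> psdu uA; split=> [|x].
  apply/matrixP => i j; rewrite mxE.
  apply: (cvg_unique (@norm_hausdorff _ _) (F := ((fun p => u p i j) @ \oo)%classic));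
    last exact: uA.
  have -> : (fun p => u p i j) = (fun p => u p j i); last exact: uA.
  by apply: funext => p; rewrite -[in LHS](psdu p).1 mxE.
rewrite quadratic_formE.
have cvg_form : ((fun p => \sum_j \sum_i x i 0 * u p i j * x j 0) @ \oo
    --> \sum_j \sum_i x i 0 * A i j * x j 0)%classic.
  apply: cvg_sum_pointwise => j; apply: cvg_sum_pointwise => i.
  by apply: cvgM (cvg_cst _); apply: cvgM (uA i j); exact: cvg_cst.
apply: (ler_cvg_to (cvg_cst 0) cvg_form).
by apply: nearW => p; rewrite -quadratic_formE; exact: (psdu p).2.
Qed.

Lemma psdD (R : realType) (m : nat) (A B : 'M[R]_m) :
  psd A -> psd B -> psd (A + B).
Proof.
move=> [At pA] [Bt pB]; split=> [|x]; first by rewrite linearD /= At Bt.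
by rewrite mulmxDr mulmxDl mxE addr_ge0.
Qed.

Lemma psdZ (R : realType) (m : nat) (a : R) (A : 'M[R]_m) :
  0 <= a -> psd A -> psd (a *: A).
Proof.
move=> a0 [At pA]; split=> [|x]; first by rewrite linearZ /= At.
by rewrite -scalemxAr -scalemxAl mxE mulr_ge0.
Qed.

(** * Convexity and closedness of the feasible set *)

Lemma feasible_midpoint (R : realType) (n k : nat) (C : 'I_k -> {set 'I_n})
    (eps : R) (A B : 'M[R]_n) :
  feasible C eps A -> feasible C eps B -> feasible C eps (2^-1 *: (A + B)).
Proof.
move=> [AU At Ale Apsd] [BU Bt Ble Bpsd]; split.
- by rewrite -scalemxAl mulmxDl AU BU addr0 scaler0.
- by apply/matrixP => i j; rewrite {1}At {1}Bt !mxE.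
- move=> i j ij; rewrite !mxE; have := Ale _ _ ij; have := Ble _ _ ij; lra.
- move=> j; rewrite /loewner_ge.
  have half0 : 0 <= 2^-1 :> R by rewrite invr_ge0.
  (* The slack of the midpoint in the semidefinite constraint is the midpoint of the two slacks. *)
  suff <- : 2^-1 *: ((principal_submx A (C j) - eps *: centering_mx R #|C j|) +
      (principal_submx B (C j) - eps *: centering_mx R #|C j|)) =
      principal_submx (2^-1 *: (A + B)) (C j) - eps *: centering_mx R #|C j|.
    exact: psdZ half0 (psdD (Apsd j) (Bpsd j)).
  by move: (eps *: _) => c; apply/matrixP => a b; rewrite !mxE; field.
Qed.

(** Each constraint is an equation, a weak inequality or a semidefinite condition on expressions
    continuous in the entries. *)
Lemma feasible_entrywise_closed (R : realType) (n k : nat)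
    (C : 'I_k -> {set 'I_n}) (eps : R) (u : nat -> 'M[R]_n) (A : 'M[R]_n) :
  (forall p, feasible C eps (u p)) -> entrywise_cvg u A -> feasible C eps A.
Proof.
move=> fu uA; split.
- apply/matrixP => i j; rewrite !mxE.
  (* This sequence tends to the entry of [A *m indicator_mx R C], and it is constantly 0. *)
  apply: (cvg_unique (@norm_hausdorff _ _)
    (F := ((fun p => \sum_l u p i l * indicator_mx R C l j) @ \oo)%classic)).
    by apply: cvg_sum_pointwise => l; apply: cvgM (uA i l) (cvg_cst _).
  have -> : (fun p => \sum_l u p i l * indicator_mx R C l j) = fun=> 0.
    apply: funext => p; have [/matrixP/(_ i j) + _ _ _] := fu p.
    by rewrite !mxE.
  exact: cvg_cst.
- apply/matrixP => i j; rewrite mxE.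
  apply: (cvg_unique (@norm_hausdorff _ _) (F := ((fun p => u p i j) @ \oo)%classic));
    first exact: uA.
  have -> : (fun p => u p i j) = (fun p => u p j i); last exact: uA.
  by apply: funext => p; have [_ /matrixP/(_ i j) + _ _] := fu p; rewrite mxE.
- move=> i j ij; apply: (ler_cvg_to (uA i j) (cvg_cst 0)).
  by apply: nearW => p; have [_ _ /(_ i j ij)] := fu p.
- move=> j; apply: (psd_entrywise_closed (u := fun p =>
    principal_submx (u p) (C j) - eps *: centering_mx R #|C j|)).
    by move=> p; have [_ _ _ /(_ j)] := fu p.
  move=> a b; rewrite mxE; under eq_fun do rewrite mxE.
  rewrite [principal_submx _ _ _ _]mxE.
  under eq_fun do rewrite [principal_submx _ _ _ _]mxE.
  exact: cvgD (uA _ _) (cvg_cst _).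
Qed.

(** * A feasible point *)

(** For a partition, this is the orthogonal projection onto the complement of the span of the
    indicator vectors. The sum over blocks describes the block-diagonal matrix without reordering
    indices. *)
Definition block_centering_mx (R : realType) (n k : nat)
    (C : 'I_k -> {set 'I_n}) : 'M[R]_n :=
  1%:M - \sum_c #|C c|%:R^-1 *: (indicator_vec R (C c) *m (indicator_vec R (C c))^T).

Lemma block_centering_mxE (R : realType) (n k : nat) (C : 'I_k -> {set 'I_n}) i j :
  block_centering_mx R C i j =
    (i == j)%:R - \sum_c #|C c|%:R^-1 * ((i \in C c)%:R * (j \in C c)%:R).
Proof.
rewrite !mxE summxE; congr (_ - _); apply: eq_bigr => c _.
by rewrite !mxE big_ord1 !mxE.
Qed.

(** By disjointness [j] lies in no other block, so only the summand of [c] survives. *)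
Lemma block_centering_mx_block (R : realType) (n k : nat)
    (C : 'I_k -> {set 'I_n}) (c : 'I_k) i j :
  block_partition C -> j \in C c ->
  block_centering_mx R C i j = (i == j)%:R - #|C c|%:R^-1 * (i \in C c)%:R.
Proof.
move=> [_ disC _] jc; rewrite block_centering_mxE (bigD1 c) //= jc mulr1.
rewrite big1 ?addr0 // => d dc; have -> : j \in C d = false; last by rewrite !mulr0.
by apply/negbTE; apply: contraTN jc => jd; rewrite (disjointFr (disC _ _ dc)).
Qed.

(** Rows sum to 0 over every block, off-diagonal entries are [-eps/|C c|] or 0, and the semidefinite
    constraints hold with equality. *)
Lemma feasible_block_centering (R : realType) (n k : nat)
    (C : 'I_k -> {set 'I_n}) (eps : R) :
  block_partition C -> 0 <= eps ->
  feasible C eps (eps *: block_centering_mx R C).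
Proof.
move=> hC eps0; have [ne0 _ _] := hC.
have symK i j : block_centering_mx R C i j = block_centering_mx R C j i.
  rewrite !block_centering_mxE eq_sym; congr (_ - _).
  by apply: eq_bigr => c _; rewrite [X in _ * X]mulrC.
split.
- rewrite -scalemxAl; apply/matrixP => i c.
  rewrite mxE [RHS]mxE [X in _ * X](_ : _ = 0) ?mulr0 // mxE.
  transitivity (\sum_(j in C c) block_centering_mx R C i j).
    rewrite [RHS]big_mkcond; apply: eq_bigr => j _.
    have -> : indicator_mx R C j c = (j \in C c)%:R by rewrite !mxE.
    by rewrite mulr_natr mulrb.
  under eq_bigr => j jc do rewrite (block_centering_mx_block _ _ hC jc).
  (* The constant terms add up to the indicator of [i] in [C c], the block size cancelling because
     blocks are nonempty. The Kronecker deltas add up to the same indicator. *)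
  rewrite big_split /= sumrN sumr_const -[X in - X]mulr_natl mulrA.
  rewrite divff ?pnatr_eq0 ?cards_eq0 ?ne0 // mul1r.
  have [ic|nic] := boolP (i \in C c).
    rewrite (bigD1 i) //= eqxx big1 ?addr0 ?subrr // => j /andP[_ ji].
    by rewrite eq_sym (negbTE ji).
  rewrite big1 ?subrr // => j jc; case: eqP => // ij.
  by rewrite ij jc in nic.
- by apply/matrixP => i j; rewrite mxE [RHS]mxE [RHS]mxE symK.
- move=> i j ij; rewrite mxE mulr_ge0_le0 // block_centering_mxE (negbTE ij).
  rewrite sub0r oppr_le0; apply: sumr_ge0 => c _.
  by rewrite !mulr_ge0 ?invr_ge0.
- move=> c; rewrite /loewner_ge; set D := _ - _.
  have -> : D = 0; last first.
    by split=> [|x]; [rewrite trmx0 | rewrite mulmx0 mul0mx mxE].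
  apply/matrixP => a b.
  have principalE : principal_submx (eps *: block_centering_mx R C) (C c) a b =
      eps * ((a == b)%:R - #|C c|%:R^-1).
    rewrite mxE mxE (block_centering_mx_block _ _ hC (enum_valP b)) enum_valP.
    by rewrite mulr1 (inj_eq enum_val_inj).
  have centeringE : centering_mx R #|C c| a b = (a == b)%:R - #|C c|%:R^-1.
    by rewrite !mxE big_ord1 !mxE !mulr1.
  by rewrite [RHS]mxE mxE principalE mxE mxE centeringE subrr.
Qed.

Theorem proposition2 (R : realType) (n k : nat) (L : 'M[R]_n)
    (C : 'I_k -> {set 'I_n}) (eps : R)
    (hL : graph_laplacian L) (hC : block_partition C) (heps : 0 < eps) :
  exists! M : 'M[R]_n,
    global_minimizer (feasible C eps)
      (fun N : 'M[R]_n => frobenius_norm (N - L) ^+ 2) M.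
Proof.
apply: frobenius_projection.
- exists (eps *: block_centering_mx R C).
  exact: feasible_block_centering (ltW heps).
- exact: feasible_midpoint.
- exact: feasible_entrywise_closed.
Qed.
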